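(* For every $p\ge\frac{1}{\sqrt n}$ there exists an $n$-player one-round communication protocol that distinguishes $\boldsymbol D_0$ from $\boldsymbol D_1$ with high probability in which every message has $O((\log\log n)(\log\log\log n))$ bits.
   Context: Needle problem with domain $[t]$, $t=\Omega(n)$, and $n$ samples. $\boldsymbol D_0$: $X_1,\dots,X_n$ i.i.d. uniform on $[t]$. $\boldsymbol D_1$: pick $\alpha$ uniformly from $[t]$; independently for each $i$, $X_i=\alpha$ with probability $p$, otherwise uniform on $[t]$. In the $n$-player one-round (one-way) communication model, player $i$ holds $X_i$ and knows its index $i$; players speak once each in the order $1,2,\dots,n$, player $i$ sending a message to player $i+1$ based on its input and the message received; shared public randomness is available and is not counted; the last player outputs the answer. The space is the maximum message length. *)

(* Defs.v *)
From mathcomp Require Import all_boot all_order all_algebra.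
From mathcomp Require Import reals exp.
Set Implicit Arguments. Unset Strict Implicit. Unset Printing Implicit Defensive.
Import Order.TTheory GRing.Theory Num.Theory.
Local Open Scope ring_scope.

Definition D0 {R : realType} (n t : nat) (x : {ffun 'I_n -> 'I_t}) : R :=
  (t%:R ^-1) ^+ n.

(* D1: alpha uniform on [t]; independently for each i, X_i = alpha w.p. p,
   otherwise uniform on [t].  Literal unfolding of the mixture:
   P(x) = (1/t) * sum_alpha prod_i (p [x_i = alpha] + (1-p)/t). *)
Definition D1 {R : realType} (n t : nat) (p : R) (x : {ffun 'I_n -> 'I_t}) : R :=
  t%:R ^-1 * \sum_(a : 'I_t) \prod_(i : 'I_n)
     (p * (x i == a)%:R + (1 - p) / t%:R).

(* For a fixed value r of the public randomness, player k (0-based index k,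
   so player k+1 in the paper) computes its message from its index, the
   message received from the previous player, and its own input.  Player 1
   receives the empty message.  The last player outputs a bit from the
   received message and its own input (true = "the input came from D1"). *)

Fixpoint exec {t : nat} (send : nat -> seq bool -> 'I_t -> seq bool)
  (decide : seq bool -> 'I_t -> bool) (k : nat) (m : seq bool) (xs : seq 'I_t)
  : bool :=
  match xs with
  | [::] => false (* never reached when n >= 1 *)
  | [:: a] => decide m a
  | a :: xs' => exec send decide k.+1 (send k m a) xs'
  end.

Definition run {Omega : Type} {n t : nat}
  (send : Omega -> nat -> seq bool -> 'I_t -> seq bool)
  (decide : Omega -> seq bool -> 'I_t -> bool)
  (r : Omega) (x : {ffun 'I_n -> 'I_t}) : bool :=
  exec (send r) (decide r) 0 [::] [seq x i | i <- enum 'I_n].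

(* Space: every message actually sent (by players 1..n-1) has at most L bits. *)
Definition space_bounded {Omega : Type} (n t L : nat)
  (send : Omega -> nat -> seq bool -> 'I_t -> seq bool) : Prop :=
  forall r k m a, (k < n.-1)%N -> (size (send r k m a) <= L)%N.

Definition prob_out {R : realType} {Omega : finType} {n t : nat}
  (mu : Omega -> R) (P : {ffun 'I_n -> 'I_t} -> R)
  (send : Omega -> nat -> seq bool -> 'I_t -> seq bool)
  (decide : Omega -> seq bool -> 'I_t -> bool) (b : bool) : R :=
  \sum_(r : Omega) \sum_(x : {ffun 'I_n -> 'I_t})
     mu r * P x * (run send decide r x == b)%:R.

(* Main.v *)
(* The protocol is deterministic. Cut the stream into slots of about K sqrt n
   samples and the domain into cells of density about 1 / (D K sqrt n), so that
   a slot contains 1/D noise hits of a given cell on average, but at least K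
   hits of the cell of the needle. A constant number M of tracks suffices to
   give every cell a slot in which its trial may start. A trial goes on as long
   as it has seen at least i hits after i slots, for i = 1, ..., W = O(log n),
   and reaching W means acceptance; only the age and the hit count, both at most
   W, are stored, since slot number and age determine the cell. By Chernoff
   bounds noise survives i slots with probability at most d^-i, and the needle's
   trial dies at slot i with probability at most d^-i; hence the needle's trial
   is rarely blocked by an older one on its track and rarely aborted, while all
   false alarms together have probability at most M n d^-W. *)
Require Import Defs.
From mathcomp Require Import all_boot all_order all_algebra.
From mathcomp Require Import reals sequences exp.
From mathcomp Require Import zify ring lra.
Import Order.TTheory GRing.Theory Num.Theory.

(** * The trial automaton of a single track, on a fixed input *)

Definition hits {T : Type} (S : pred T) (y : nat -> T) (lo hi : nat) : nat :=
  \sum_(lo <= i < hi) S (y i).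

Lemma hits_recr {T : Type} (S : pred T) (y : nat -> T) (lo hi : nat) :
  lo <= hi -> hits S y lo hi.+1 = hits S y lo hi + S (y hi).
Proof. by move=> le_lh; rewrite /hits big_nat_recr. Qed.

Lemma hits_geq {T : Type} (S : pred T) (y : nat -> T) (lo hi : nat) :
  hi <= lo -> hits S y lo hi = 0.
Proof. by move=> le_hl; rewrite /hits big_geq. Qed.

Fixpoint states {St T : Type} (step : nat -> St -> T -> St) (s0 : St)
    (y : nat -> T) (k : nat) : St :=
  if k is k'.+1 then step k' (states step s0 y k') (y k') else s0.

Definition track (W : nat) : finType := ('I_W.+1 * 'I_W.+1)%type.

(* A pair (age in slots of the current trial, hits of its cell so far, capped
   at W); slots have length B, and the trial opened in slot j watches [S j].
   Age W is absorbing and means acceptance. *)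
Definition track_step {T : Type} (W B : nat) (S : nat -> pred T) (k : nat)
    (s : track W) (x : T) : track W :=
  let c := minn W (s.2 + S (k %/ B - s.1) x) in
  if s.1 == W :> nat then s
  else if ~~ (B %| k.+1) then (s.1, inord c)
  else if c <= s.1 then (ord0, ord0) else (inord s.1.+1, inord c).

(** The opening slot [j] is not part of the state; before acceptance it is recovered from
    [j + s.1 = k %/ B]. The last clause remembers the most recent check passed. The absorbing state
    keeps no age in time, so there only the existence of a successful trial survives. *)
Definition track_inv {T : Type} (W B : nat) (S : nat -> pred T) (y : nat -> T)
    (k : nat) (s : track W) : Prop :=
  if s.1 == W :> nat then
    exists2 j, (j + W) * B <= k & W <= hits (S j) y (j * B) ((j + W) * B)
  else exists j, [/\ j + s.1 = k %/ B,
    s.2 = minn W (hits (S j) y (j * B) k) :> nat &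
    s.1 <= hits (S j) y (j * B) ((j + s.1) * B)].

Lemma track_invP {T : Type} (W B : nat) (S : nat -> pred T) (y : nat -> T) k :
  0 < W -> 0 < B ->
  track_inv W B S y k (states (track_step W B S) (ord0, ord0) y k).
Proof.
move=> W0 B0; elim: k => [|k] /=.
  rewrite /track_inv /= eq_sym eqn0Ngt W0 /=; exists 0.
  by rewrite div0n mul0n hits_geq // minn0.
move: (states _ _ _ _) => [a c]; rewrite {1}/track_inv /track_step /=.
case: eqP => [aW [j le_jk hj]|aW [j [jk cE ha]]].
  by rewrite /track_inv /= aW eqxx; exists j => //; apply: leqW.
have ltaW : a < W by rewrite ltn_neqAle -ltnS ltn_ord andbT; apply/eqP.
have le_jBk : j * B <= k.
  by apply: leq_trans (leq_divM k B); rewrite leq_mul2r -jk leq_addr orbT.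
have -> : k %/ B - a = j by rewrite -jk addnK.
have cE' : minn W (c + S j (y k)) = minn W (hits (S j) y (j * B) k.+1).
  by rewrite hits_recr // cE; lia.
rewrite cE'; have leW x : minn W x < W.+1 by rewrite ltnS geq_minl.
case: ifP => dv.
  rewrite /track_inv /=; case: eqP => // _; exists j; split => //.
    by rewrite jk divnS // (negbTE dv) add0n.
  by rewrite inordK.
move/negbFE: dv => dv.
have kB : k.+1 %/ B = (j + a).+1 by rewrite divnS // dv jk.
have kE : k.+1 = (j + a).+1 * B by rewrite -kB divnK.
case: ifP => ca.
  rewrite /track_inv /= eq_sym eqn0Ngt W0 /=; exists (j + a).+1.
  by rewrite addn0 kB -kE hits_geq // minn0.
rewrite /track_inv /= (@inordK W a.+1) //.
(* As [a < W], the cap at [W] does not affect the comparison of the count with the age. *)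
have hE : a < hits (S j) y (j * B) k.+1.
  by move: ca; rewrite leqNgt => /negbFE; rewrite leq_min => /andP[].
case: eqP => aE.
  by exists j; rewrite -aE addnS -kE // -aE.
by exists j; rewrite kB addnS inordK // -kE.
Qed.

Lemma track_accept {T : Type} (W B : nat) (S : nat -> pred T) (y : nat -> T) n :
  0 < W -> 0 < B ->
  (states (track_step W B S) (ord0, ord0) y n).1 = W :> nat ->
  exists2 j, (j + W) * B <= n & W <= hits (S j) y (j * B) ((j + W) * B).
Proof.
move=> W0 B0 sW; have := track_invP W B S y n W0 B0.
by rewrite /track_inv sW eqxx.
Qed.

Lemma track_absorb {T : Type} (W B : nat) (S : nat -> pred T) (y : nat -> T)
    s0 k k' :
  k <= k' -> (states (track_step W B S) s0 y k).1 = W :> nat ->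
  (states (track_step W B S) s0 y k').1 = W :> nat.
Proof.
move=> /subnKC <-; elim: (k' - k) => [|i IH] h; rewrite ?addn0 ?addnS //=.
by rewrite /track_step IH // eqxx IH.
Qed.

(** At the start of slot [j] the track is either occupied or free. If occupied, the older trial has
    passed its latest check, made exactly at [j * B]. If free, the trial of [S j] opens there, and
    passing all [W] checks would lead to acceptance. *)
Lemma track_reject {T : Type} (W B : nat) (S : nat -> pred T) (y : nat -> T)
    n j :
  0 < W -> 0 < B -> (j + W) * B <= n ->
  (states (track_step W B S) (ord0, ord0) y n).1 <> W :> nat ->
  (exists2 a, a < j &
     a.+1 <= hits (S (j - a.+1)) y ((j - a.+1) * B) (j * B)) \/
  (exists2 i, i < W & hits (S j) y (j * B) ((j + i.+1) * B) <= i).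
Proof.
move=> W0 B0 jn rej.
set st := states _ _ _ in rej *.
have nacc k : k <= n -> (st k).1 != W :> nat.
  by move=> kn; apply/eqP => h; apply: rej; apply: track_absorb h.
have inv k := track_invP W B S y k W0 B0.
have jBn : j * B <= n by apply: leq_trans jn; rewrite leq_mul2r leq_addr orbT.
(* A positive age [a.+1] at this time means a trial opened in slot [j - a.+1]. *)
case a0: (nat_of_ord (st (j * B)).1) => [|a]; last first.
  left; have := inv (j * B); rewrite -/(st (j * B)) /track_inv.
  rewrite (negbTE (nacc _ jBn)) mulnK // a0 => -[j' [<- _ h]].
  by exists a; rewrite ?addnK //; lia.
right; case: (boolP [exists i : 'I_W,
    hits (S j) y (j * B) ((j + i.+1) * B) <= i]) => [/existsP[i hi]|].
  by exists i.
rewrite negb_exists => /forallP good.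
(* If no check fails, the age after [d] further samples counts the completed slots; [d = W * B] then
   contradicts rejection. *)
suff age d : d <= W * B -> (st (j * B + d)).1 = d %/ B :> nat.
  have := nacc _ jn; rewrite mulnDl age // mulnK //.
  by rewrite eqxx.
elim: d => [|d IH] ltd; first by rewrite addn0 a0 div0n.
have {}IH := IH (ltnW ltd).
have dn : j * B + d <= n by apply: leq_trans jn; rewrite mulnDl leq_add2l ltnW.
have na := nacc _ dn.
have := inv (j * B + d); rewrite -/(st _) /track_inv (negbTE na) IH divnMDl //.
move=> -[j' [/addIn -> cE _]].
rewrite addnS /st /= -/(st _) /track_step (negbTE na) IH divnMDl // addnK.
rewrite cE.
have -> : minn W (minn W (hits (S j) y (j * B) (j * B + d)) +
    S j (y (j * B + d))) = minn W (hits (S j) y (j * B) (j * B + d).+1).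
  by rewrite hits_recr ?leq_addr //; lia.
rewrite -addnS dvdn_addr ?dvdn_mull //.
case: ifP => dv; first by rewrite IH divnS // (negbTE dv).
move/negbFE: dv => dv.
have dW : d %/ B < W by rewrite -IH ltn_neqAle na -ltnS ltn_ord.
have := good (Ordinal dW); rewrite -ltnNge /= => gd.
have dE : d.+1 = (d %/ B).+1 * B.
  by rewrite -[LHS](divnK dv) divnS // dv.
have -> : j * B + d.+1 = (j + (d %/ B).+1) * B by rewrite dE mulnDl.
by rewrite leqNgt leq_min dW gd /= inordK // divnS // dv.
Qed.

(** * From automata to a protocol with short messages *)

Definition block_hits {n : nat} {T : Type} (S : pred T) (x : 'I_n -> T)
    (lo hi : nat) : nat :=
  \sum_(i < n | lo <= i < hi) S (x i).

Lemma hits_block {n : nat} {T : Type} (S : pred T) (x : 'I_n -> T)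
    (y : nat -> T) (lo hi : nat) :
  (forall i : 'I_n, y i = x i) -> hi <= n -> hits S y lo hi = block_hits S x lo hi.
Proof.
move=> yx le_n; rewrite /hits /block_hits (big_nat_widen _ _ _ _ _ le_n).
rewrite (big_nat_widenl _ 0) // big_mkord; apply: eq_big => [i|i _]; last by rewrite yx.
by rewrite andbC.
Qed.

(** All codes have length exactly [L], which is positive, so the empty word is free to decode to
    [q0]. Thus the empty message received by the first player stands for the initial state. *)
Lemma state_code (Q : finType) (q0 : Q) (L : nat) :
  0 < L -> #|Q| <= 2 ^ L ->
  exists (enc : Q -> seq bool) (dec : seq bool -> Q),
    [/\ cancel enc dec, dec [::] = q0 & forall q, size (enc q) <= L].
Proof.
move=> L0; rewrite -card_bool -card_tuple => le_card.
pose enc (q : Q) := val (enum_val (widen_ord le_card (enum_rank q))).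
have enc_inj : injective enc.
  move=> q q' /val_inj/enum_val_inj/(congr1 val)/= /val_inj.
  exact: enum_rank_inj.
exists enc, (fun m => odflt q0 [pick q | enc q == m]); split.
- move=> q; case: pickP => [q' /eqP/enc_inj //|/(_ q)]; by rewrite eqxx.
- case: pickP => // q /eqP/(congr1 size); rewrite size_tuple => L_eq0.
  by rewrite L_eq0 in L0.
- by move=> q; rewrite size_tuple.
Qed.

Lemma run_states {Omega St : Type} {n t : nat} (enc : St -> seq bool)
    (dec : seq bool -> St) (step : nat -> St -> 'I_t -> St) (acc : St -> bool)
    (r : Omega) (x : {ffun 'I_n -> 'I_t}) (y : nat -> 'I_t) :
  0 < n -> (forall i : 'I_n, y i = x i) -> cancel enc dec ->
  run (fun _ k m a => enc (step k (dec m) a))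
      (fun _ m a => acc (step n.-1 (dec m) a)) r x =
  acc (states step (dec [::]) y n).
Proof.
move=> n0 yx encK; rewrite /run.
have -> : [seq x i | i <- enum 'I_n] = [seq y i | i <- iota 0 n].
  by rewrite -val_enum_ord -map_comp; apply: eq_map => i /=; rewrite yx.
(* Induction on the number [j] of players left. The incoming message need only decode to the current
   state, which also covers the empty one. *)
suff gen j : forall k m, 0 < j -> k + j = n -> dec m = states step (dec [::]) y k ->
    exec (fun k m a => enc (step k (dec m) a))
      (fun m a => acc (step n.-1 (dec m) a)) k m [seq y i | i <- iota k j] =
    acc (states step (dec [::]) y n) by apply: gen.
elim: j => [//|[|j] IH] k m _ kn mE.
  by rewrite /= -kn addn1 /= mE.
have {}IH := IH k.+1 (enc (step k (dec m) (y k))).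
by apply: IH; rewrite // ?addSnnS // encK mE.
Qed.

Lemma parallel_tracks {t : nat} (M W B n L : nat) (S : nat -> nat -> pred 'I_t) :
  0 < W -> 0 < B -> 0 < n -> 0 < L -> (W.+1 * W.+1) ^ M <= 2 ^ L ->
  exists (send : unit -> nat -> seq bool -> 'I_t -> seq bool)
         (decide : unit -> seq bool -> 'I_t -> bool),
  [/\ @space_bounded unit n t L send,
   forall x : {ffun 'I_n -> 'I_t}, run send decide tt x ->
     exists (m : 'I_M) (j : nat), (j + W) * B <= n /\
       W <= block_hits (S m j) x (j * B) ((j + W) * B) &
   forall (x : {ffun 'I_n -> 'I_t}) (m : 'I_M) (j : nat),
     (j + W) * B <= n -> ~~ run send decide tt x ->
     (exists2 a, a < j & a.+1 <=
        block_hits (S m (j - a.+1)) x ((j - a.+1) * B) (j * B)) \/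
     (exists2 i, i < W &
        block_hits (S m j) x (j * B) ((j + i.+1) * B) <= i)].
Proof.
move=> W0 B0 n0 L0 le_card.
pose Q : finType := {ffun 'I_M -> track W}.
pose q0 : Q := [ffun=> (ord0, ord0)].
have [enc [dec [encK dec0 enc_size]]] : exists (enc : Q -> seq bool)
    (dec : seq bool -> Q),
    [/\ cancel enc dec, dec [::] = q0 & forall q, size (enc q) <= L].
  by apply: state_code => //; rewrite card_ffun card_prod !card_ord.
pose step (k : nat) (q : Q) (a : 'I_t) : Q := [ffun m : 'I_M => track_step W B (S m) k (q m) a].
pose acc (q : Q) := [exists m : 'I_M, (q m).1 == W :> nat].
exists (fun _ k m a => enc (step k (dec m) a)),
  (fun _ m a => acc (step n.-1 (dec m) a)).
have stE (y : nat -> 'I_t) (k : nat) (m : 'I_M) : states step q0 y k m =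
    states (track_step W B (S m)) (ord0, ord0) y k.
  by elim: k => [|k IH] /=; rewrite ffunE // IH.
have ext (x : {ffun 'I_n -> 'I_t}) :
    {y : nat -> 'I_t | forall i : 'I_n, y i = x i}.
  (* Indices from [n] on get the default value [x] at 0; they are never read. *)
  exists (fun k => x (insubd (Ordinal n0) k)) => i; congr (x _).
  by apply: val_inj; rewrite val_insubd ltn_ord.
split=> [r k m a _|x|x m j jn]; first exact: enc_size.
  have [y yx] := ext x; rewrite (run_states _ _ _ _ _ _ y) // dec0.
  case/existsP=> m; rewrite stE => /eqP/(track_accept _ _ _ _ _ W0 B0)[j jn h].
  by exists m, j; rewrite -(hits_block _ _ y).
have [y yx] := ext x; rewrite (run_states _ _ _ _ _ _ y) // dec0.
rewrite negb_exists => /forallP/(_ m); rewrite stE => /eqP rej.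
have le_n i : i <= W -> (j + i) * B <= n.
  by move=> iW; apply: leq_trans jn; rewrite leq_mul2r leq_add2l iW orbT.
case: (track_reject _ _ _ _ _ _ W0 B0 jn rej) => -[a ha h]; [left|right];
  exists a => //.
  by rewrite -(hits_block _ _ y) //; move: (le_n 0); rewrite addn0; apply.
by rewrite -(hits_block _ _ y) //; apply: le_n.
Qed.

(** * Chernoff bounds for hit counts *)

Local Open Scope ring_scope.

(** By independence the moment generating function factors over the coordinates, and those outside
    the window contribute 1. *)
Lemma block_hits_mgf {R : comNzRingType} {T : finType} (n : nat) (w : T -> R)
    (l : R) (S : pred T) (lo hi : nat) :
  \sum_a w a = 1 -> (hi <= n)%N ->
  \sum_(x : {ffun 'I_n -> T}) (\prod_i w (x i)) * l ^+ block_hits S x lo hi =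
  (1 + (l - 1) * \sum_(a | S a) w a) ^+ (hi - lo).
Proof.
move=> w1 hin; pose F (i : 'I_n) a :=
  w a * (if (lo <= i < hi)%N then l ^+ S a else 1).
transitivity (\sum_(x : {ffun 'I_n -> T}) \prod_i F i (x i)).
  apply: eq_bigr => x _; rewrite big_split /=; congr (_ * _).
  by rewrite /block_hits expr_sum big_mkcond.
rewrite -bigA_distr_bigA /=.
have FE (i : 'I_n) : \sum_a F i a =
    if (lo <= i < hi)%N then 1 + (l - 1) * \sum_(a | S a) w a else 1.
  rewrite /F; case: ifP => _; last by under eq_bigr do rewrite mulr1.
  rewrite -[X in _ = X + _]w1 mulr_sumr [X in _ = _ + X]big_mkcond -big_split /=.
  by apply: eq_bigr => a _; case: (S a); rewrite /= ?expr1 ?expr0; ring.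
under eq_bigr do rewrite FE.
rewrite -big_mkcond /= -prodr_const_nat [RHS](big_nat_widen _ _ n) //.
rewrite (big_nat_widenl _ 0) // big_mkord; apply: eq_bigl => i.
by rewrite andbC.
Qed.

(** Markov's inequality for [D ^+ hits] with [D = 4 * d]: one slot contributes at most
    [expR (D * q * B) <= expR 1 <= 4], and [4 / D] is [d%:R^-1]. *)
Lemma noise_tail {R : realType} {T : finType} (n : nat) (w : T -> R)
    (S : pred T) (d B a lo hi : nat) :
  (forall b, 0 <= w b) -> \sum_b w b = 1 -> (0 < d)%N ->
  (\sum_(b | S b) w b) * (B * (4 * d))%:R <= 1 ->
  hi = (lo + a * B)%N -> (hi <= n)%N ->
  \sum_(x : {ffun 'I_n -> T})
     (\prod_i w (x i)) * (a <= block_hits S x lo hi)%N%:R <= d%:R^-1 ^+ a.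
Proof.
move=> w0 w1 d0 sB hiE hin; set q := \sum_(b | S b) w b in sB.
have q0 : 0 <= q by apply: sumr_ge0.
set D : R := (4 * d)%:R.
have d1 : 1 <= d%:R :> R by rewrite ler1n.
have DE : D = 4 * d%:R by rewrite /D natrM.
have D1 : 1 <= D by lra.
have D0 : 0 < D by lra.
have base : (1 + (D - 1) * q) ^+ B <= 4.
  have le1 : 1 + (D - 1) * q <= expR (D * q).
    by apply: le_trans (expR_ge1Dx _); nra.
  have ge0 : 0 <= 1 + (D - 1) * q by nra.
  apply: (le_trans (y := expR 1)).
    apply: (le_trans (lerXn2r _ _ _ le1)); rewrite ?nnegrE ?expR_ge0 //.
    rewrite -expRM_natr ler_expR; move: sB; rewrite natrM -/D.
    by nra.
  (* From [expR (- 2^-1) >= 2^-1] follows [expR (2^-1) <= 2], hence [expR 1 <= 4]. *)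
  have := expR_ge1Dx (- (2^-1) : R); have := expR_gt0 (2^-1 : R).
  have : expR (2^-1) * expR (- 2^-1) = 1 :> R by rewrite -expRD subrr expR0.
  have -> : expR 1 = expR (2^-1) * expR (2^-1) :> R.
    by rewrite -expRD; congr expR; lra.
  set u := expR _; set v := expR _ => uv u0 hv.
  have : u <= 2 by nra.
  by nra.
apply: (le_trans (y := \sum_(x : {ffun 'I_n -> T})
    (\prod_i w (x i)) * D ^+ block_hits S x lo hi * D ^- a)).
  apply: ler_sum => x _; rewrite -mulrA ler_wpM2l ?prodr_ge0 //.
  case: leqP => [le_ah|_] /=.
    by rewrite ler_pdivlMr ?exprn_gt0 // mul1r ler_weXn2l.
  by rewrite divr_ge0 ?exprn_ge0 // ltW.
rewrite -mulr_suml block_hits_mgf // hiE addKn -/q mulnC exprM -exprVn -exprMn.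
apply: lerXn2r; rewrite ?nnegrE ?invr_ge0 ?ler0n //.
  by rewrite divr_ge0 ?exprn_ge0 //; nra.
rewrite ler_pdivrMr // DE mulrCA mulVf ?mulr1 //.
  by rewrite -DE.
by rewrite pnatr_eq0 -lt0n.
Qed.

(** Markov's inequality for [2^-1 ^+ hits]: one slot contributes at most
    [expR (- (p * B / 2)) <= expR (- (2 * d))]. The threshold costs [2 ^+ i.+1], one factor 2 more
    than necessary, so that each slot gets one factor and [2 * expR (- (2 * d)) <= d%:R^-1] can be
    applied. *)
Lemma signal_tail {R : realType} {T : finType} (n : nat) (w : T -> R) (p : R)
    (S : pred T) (d B i lo hi : nat) :
  (forall b, 0 <= w b) -> \sum_b w b = 1 -> (0 < d)%N ->
  p <= \sum_(b | S b) w b -> (4 * d)%:R <= p * B%:R ->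
  hi = (lo + i.+1 * B)%N -> (hi <= n)%N ->
  \sum_(x : {ffun 'I_n -> T})
     (\prod_i w (x i)) * (block_hits S x lo hi <= i)%N%:R <= d%:R^-1 ^+ i.+1.
Proof.
move=> w0 w1 d0 pq pB hiE hin; set q := \sum_(b | S b) w b in pq.
have q1 : q <= 1.
  rewrite -w1 /q big_mkcond; apply: ler_sum => b _; by case: ifP.
have d1 : 1 <= d%:R :> R by rewrite ler1n.
have base0 : 0 <= 1 + (2^-1 - 1) * q by lra.
have base : 2 * (1 + (2^-1 - 1) * q) ^+ B <= d%:R^-1.
  have le1 : 1 + (2^-1 - 1) * q <= expR (- (p / 2)).
    by apply: le_trans (expR_ge1Dx _); lra.
  have le2 : (1 + (2^-1 - 1) * q) ^+ B <= expR (- (2 * d%:R)).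
    apply: (le_trans (lerXn2r _ _ _ le1)); rewrite ?nnegrE ?expR_ge0 //.
    rewrite -expRM_natr ler_expR; move: pB; rewrite natrM.
    by lra.
  apply: (le_trans (ler_wpM2l _ le2)) => //.
  rewrite -[leRHS]mulr1 ler_pdivlMl; last by lra.
  have := expR_ge1Dx (2 * d%:R : R); have := expR_gt0 (- (2 * d%:R) : R).
  have : expR (2 * d%:R) * expR (- (2 * d%:R)) = 1 :> R.
    by rewrite -expRD subrr expR0.
  set u := expR _; set v := expR _ => uv v0 hu.
  by nra.
apply: (le_trans (y := \sum_(x : {ffun 'I_n -> T})
    (\prod_i w (x i)) * 2^-1 ^+ block_hits S x lo hi * 2 ^+ i.+1)).
  apply: ler_sum => x _; rewrite -mulrA ler_wpM2l ?prodr_ge0 //.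
  case: leqP => [le_hi|_] /=; last by rewrite mulr_ge0 ?exprn_ge0 ?invr_ge0.
  rewrite exprVn ler_pdivlMl ?exprn_gt0 // mulr1 ler_weXn2l ?ler1n //.
  exact: leqW.
rewrite -mulr_suml block_hits_mgf // hiE addKn -/q mulnC exprM -exprMn.
apply: lerXn2r; rewrite ?nnegrE ?invr_ge0 ?ler0n //.
  by rewrite mulr_ge0 ?exprn_ge0.
by rewrite mulrC.
Qed.

(** * Cells of the domain and the two error probabilities *)

Definition cell {t : nat} (s e : nat) : pred 'I_t := [pred x : 'I_t | x %/ s == e]%N.

Lemma card_cell {t : nat} (s e : nat) : (0 < s)%N -> (#|@cell t s e| <= s)%N.
Proof.
move=> s0; pose f (x : 'I_t) := Ordinal (ltn_pmod x s0).
rewrite -[leqRHS](card_ord s); apply: (leq_card_in f) => x y.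
rewrite !inE => /eqP xe /eqP ye /(congr1 val)/= xy; apply: val_inj => /=.
by rewrite (divn_eq x s) (divn_eq y s) xe ye xy.
Qed.

Lemma cell_weight {R : realType} {t : nat} (w : 'I_t -> R) (s e c : nat) :
  (0 < s)%N -> (s * c <= t)%N -> (0 < t)%N ->
  (forall b, cell s e b -> w b <= t%:R^-1) ->
  (\sum_(b | cell s e b) w b) * c%:R <= 1.
Proof.
move=> s0 sct t0 wle.
have t0' : 0 < t%:R :> R by rewrite ltr0n.
apply: (le_trans (y := s%:R / t%:R * c%:R)); last first.
  by rewrite mulrAC ler_pdivrMr // mul1r -natrM ler_nat.
rewrite ler_wpM2r ?ler0n //.
apply: (le_trans (ler_sum _ wle)).
rewrite sumr_const -[leLHS]mulr_natl ler_wpM2r ?invr_ge0 ?ler0n // ler_nat.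
exact: card_cell.
Qed.

Lemma union_bound {R : realType} {T I : finType} (P : T -> R) (E : pred T)
    (F : I -> pred T) :
  (forall x, 0 <= P x) -> (forall x, E x -> exists i, F i x) ->
  \sum_x P x * (E x)%:R <= \sum_i \sum_x P x * (F i x)%:R.
Proof.
move=> P0 EF; rewrite exchange_big /=; apply: ler_sum => x _.
rewrite -mulr_sumr ler_wpM2l // -natr_sum ler_nat.
case: (boolP (E x)) => // /EF[i Fi].
by rewrite (bigD1 i) //= Fi.
Qed.

Lemma geometric_le {R : realFieldType} (r : R) (N : nat) :
  0 <= r -> 2 * r <= 1 -> \sum_(i < N) r ^+ i.+1 <= 2 * r.
Proof.
move=> r0 r1.
(* The term [2 * r ^+ N.+1] dominates the missing tail and makes the induction go through. *)
suff : \sum_(i < N) r ^+ i.+1 + 2 * r ^+ N.+1 <= 2 * r.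
  by apply: le_trans; rewrite lerDl mulr_ge0 ?exprn_ge0.
elim: N => [|N IH]; first by rewrite big_ord0 add0r expr1.
rewrite big_ord_recr /=; apply: le_trans IH; rewrite -addrA lerD2l.
by have := exprn_ge0 N.+1 r0; rewrite [r ^+ N.+2]exprS; nra.
Qed.

(** The false alarm bound is a union over at most [M * n] trials. The miss bound is [2 / d] for the
    needle's trial being blocked by an older one plus [2 / d] for its being aborted. *)
Lemma needle_protocol {R : realType} (n t d B W M s L : nat) (p : R) :
  (1 < d)%N -> (0 < B)%N -> (0 < W)%N -> (0 < M)%N -> (0 < s)%N -> (0 < n)%N ->
  (0 < L)%N -> ((W.+1 * W.+1) ^ M <= 2 ^ L)%N ->
  (s * (B * (4 * d)) <= t)%N -> ((t %/ s %/ M + W) * B <= n)%N ->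
  0 <= p -> p <= 1 -> (4 * d)%:R <= p * B%:R ->
  exists (send : unit -> nat -> seq bool -> 'I_t -> seq bool)
         (decide : unit -> seq bool -> 'I_t -> bool),
  [/\ @space_bounded unit n t L send,
    prob_out (fun _ => 1) (@D0 R n t) send decide true
      <= (M * n)%:R * d%:R^-1 ^+ W &
    prob_out (fun _ => 1) (@D1 R n t p) send decide false <= 4 / d%:R].
Proof.
move=> d1 B0 W0 M0 s0 n0 L0 le_card st fit p0 p1 pB.
have d0 : (0 < d)%N by apply: ltnW.
have t0 : (0 < t)%N.
  by apply: leq_trans st; rewrite !muln_gt0 s0 B0 d0.
have t0' : 0 < t%:R :> R by rewrite ltr0n.
have dR : 2 <= d%:R :> R by rewrite ler_nat.
have di0 : 0 <= d%:R^-1 :> R by rewrite invr_ge0 ler0n.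
have di2 : 2 * d%:R^-1 <= 1 :> R by rewrite ler_pdivrMr; lra.
(* Division with remainder by [M] assigns each cell number exactly one slot [j] and track
   [m < M]. *)
pose S (m j : nat) := @cell t s (j * M + m)%N.
have [send [decide [spc sound compl]]] :=
  parallel_tracks M W B n L S W0 B0 n0 L0 le_card.
exists send, decide; split=> //.
  have outE : prob_out (fun _ => 1) (@D0 R n t) send decide true =
      \sum_(x : {ffun 'I_n -> 'I_t}) (\prod_(i < n) t%:R^-1) * (run send decide tt x)%:R.
    rewrite /prob_out (big_pred1 tt) => [|[]] //; apply: eq_bigr => x _.
    by rewrite mul1r /D0 prodr_const card_ord eqb_id.
  rewrite outE.
  apply: (le_trans (union_bound _ _ (fun (i : 'I_M * 'I_n) (x : {ffun 'I_n -> 'I_t}) =>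
    ((i.2 + W) * B <= n)%N &&
    (W <= block_hits (S i.1 i.2) x (i.2 * B) ((i.2 + W) * B))%N) _ _)).
  - by move=> x; apply: prodr_ge0 => i _; rewrite invr_ge0 ltW.
  - move=> x /sound[m [j [jn h]]].
    have ltjn : (j < n)%N.
      by apply: leq_trans jn; rewrite -[(j.+1)%N]muln1 leq_mul //; lia.
    by exists (m, Ordinal ltjn); rewrite /= jn.
  have -> : (M * n)%:R * d%:R^-1 ^+ W =
      \sum_(i : 'I_M * 'I_n) d%:R^-1 ^+ W :> R.
    by rewrite sumr_const card_prod !card_ord mulr_natl.
  apply: ler_sum => -[m j] _ /=.
  case: leqP => jn; last first.
    rewrite big1 ?exprn_ge0 // => x _; by rewrite mulr0.
  apply: (noise_tail n (fun _ => t%:R^-1) _ d B W) => //.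
  - by move=> _; rewrite invr_ge0 ltW.
  - by rewrite sumr_const card_ord -[LHS]mulr_natl divff ?lt0r_neq0.
  - exact: cell_weight.
  - by rewrite mulnDl.
have outE : prob_out (fun _ => 1) (@D1 R n t p) send decide false =
    t%:R^-1 * \sum_(a : 'I_t) \sum_(x : {ffun 'I_n -> 'I_t})
      (\prod_i (p * (x i == a)%:R + (1 - p) / t%:R)) *
      (~~ run send decide tt x)%:R.
  rewrite /prob_out (big_pred1 tt) => [|[]] //.
  rewrite exchange_big mulr_sumr /=; apply: eq_bigr => x _.
  by rewrite mul1r /D1 -mulrA -mulr_suml eqbF_neg.
rewrite outE ler_pdivrMl //.
have -> : t%:R * (4 / d%:R) = \sum_(a : 'I_t) (4 / d%:R) :> R.
  by rewrite sumr_const card_ord mulr_natl.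
(* [D1] averages over the needle, so it suffices to treat each [a] separately; the samples are then
   i.i.d. with weight [w]. *)
apply: ler_sum => a _.
pose w b : R := p * (b == a)%:R + (1 - p) / t%:R.
have w0 b : 0 <= w b.
  by rewrite addr_ge0 ?mulr_ge0 ?invr_ge0 ?ler0n ?subr_ge0.
have w1 : \sum_b w b = 1.
  rewrite big_split /= -mulr_sumr (bigD1 a) //= eqxx big1 => [|b /negbTE-> //].
  rewrite sumr_const card_ord -[X in _ + X]mulr_natl mulrCA divff ?lt0r_neq0 //.
  by rewrite /=; ring.
pose e := (a %/ s)%N.
have Mm : (e %% M < M)%N by rewrite ltn_mod.
pose m := Ordinal Mm; pose j := (e %/ M)%N.
have jn : ((j + W) * B <= n)%N.
  apply: leq_trans fit; rewrite leq_mul2r leq_add2r.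
  by rewrite !leq_div2r ?orbT // ltnW.
(* [inl k] is blocking by the trial opened [k.+1] slots earlier, [inr k] is abortion at check
   [k.+1]. *)
apply: (le_trans (union_bound _ _ (fun (i : 'I_j + 'I_W) (x : {ffun 'I_n -> 'I_t}) =>
    match i with
    | inl k => (k.+1 <=
        block_hits (S m (j - k.+1)) x ((j - k.+1) * B) (j * B))%N
    | inr k => (block_hits (S m j) x (j * B) ((j + k.+1) * B) <= k)%N
    end) _ _)).
- by move=> x; apply: prodr_ge0 => i _; apply: w0.
- move=> x /(compl _ m j jn)[[k kj h]|[k kW h]].
    by exists (inl (Ordinal kj)).
  by exists (inr (Ordinal kW)).
have -> : 4 / d%:R = 2 * d%:R^-1 + 2 * d%:R^-1 :> R by ring.
rewrite big_sumType /=; apply: lerD.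
  apply: le_trans (geometric_le _ j di0 di2); apply: ler_sum => k _.
  have kj := ltn_ord k.
  apply: (noise_tail n w _ d B k.+1) => //.
  - apply: cell_weight => // b /eqP be.
    (* Earlier slots of the same track watch other cells than the needle's, so their points carry
       only the noise weight, at most [t%:R^-1]. *)
    have ba : (b == a) = false.
      apply/eqP => ba; move: be; rewrite ba => be.
      have := etrans (esym (divn_eq e M)) be; rewrite -/j /= => /eqP.
      by rewrite eqn_add2r eqn_pmul2r // => /eqP; lia.
    by rewrite /w ba mulr0 add0r ler_piMl ?invr_ge0 ?ler0n // gerBl.
  - by rewrite -mulnDl subnK.
  - by apply: leq_trans jn; rewrite leq_mul2r leq_addr orbT.
apply: le_trans (geometric_le _ W di0 di2); apply: ler_sum => k _.
apply: (signal_tail n w p _ d B k) => //.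
- have Sa : S m j a by rewrite /S /cell /= -divn_eq.
  rewrite (bigD1 a) //= {1}/w eqxx mulr1.
  have : 0 <= \sum_(b | S m j b && (b != a)) w b.
    by apply: sumr_ge0 => b _; apply: w0.
  have : 0 <= (1 - p) / t%:R by rewrite mulr_ge0 ?invr_ge0 ?ler0n ?subr_ge0.
  by lra.
- by rewrite mulnDl.
- apply: leq_trans jn; rewrite leq_mul2r leq_add2l; have := ltn_ord k; lia.
Qed.

(** * Arithmetic of the parameters *)

Lemma nat_sqrt (n : nat) : {r : nat | (r * r <= n < r.+1 * r.+1)%N}.
Proof.
elim: n => [|n [r /andP[lo hi]]]; first by exists 0%N.
case: (ltnP n.+1 (r.+1 * r.+1)) => h; first by exists r; rewrite h andbT ltnW.
by exists r.+1; rewrite h /=; nia.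
Qed.

Lemma sqr_le_exp2 (m : nat) : (4 <= m)%N -> (m * m <= 2 ^ m)%N.
Proof.
elim: m => // m IH; rewrite leq_eqVlt => /orP[/eqP <- //|]; rewrite ltnS => m4.
by have := IH m4; rewrite expnS; nia.
Qed.

Lemma nat_above {R : realType} (x : R) : exists k : nat, x <= k%:R.
Proof.
exists (Num.bound `|x|); apply: le_trans (ler_norm x) _.
by apply: ltW; apply: archi_boundP.
Qed.

Lemma le_ln_of_expR {R : realType} (x y : R) : expR y <= x -> y <= ln x.
Proof.
move=> h; rewrite -ler_expR lnK // posrE.
exact: lt_le_trans (expR_gt0 _) h.
Qed.

Lemma le_2ln_of_exp2 {R : realType} (k : nat) (x : R) :
  2 ^+ k <= x -> k%:R <= 2 * ln x.
Proof.
move=> h; suff : k%:R / 2 <= ln x by lra.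
apply: le_ln_of_expR; apply: le_trans h.
rewrite expRM_natl lerXn2r ?nnegrE ?expR_ge0 //.
have := expR_ge1Dx (- 2^-1 : R); have := expR_gt0 (2^-1 : R).
have := expRxMexpNx_1 (2^-1 : R).
set u := expR _; set v := expR _ => uv u0 hv.
by nra.
Qed.

(** Half of the [n] samples pays for the [W] slots of a trial, half for the slots before it opens.
    With [t %/ s <= 2 * c] and [c = 16 * d ^ 2 * r.+1], the constant [1024 * d ^ 3] makes the latter
    take at most [r.+1 ^ 2 / 8 <= n / 2] samples. *)
Lemma needle_fit (n t d r s B W : nat) :
  (0 < d)%N -> (r * r <= n < r.+1 * r.+1)%N -> (2 ^ (32 * d) <= r)%N ->
  B = (4 * d * r.+1)%N -> W = (trunc_log 2 r).+1 ->
  s = (t %/ (B * (4 * d)))%N -> (0 < s)%N ->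
  ((t %/ s %/ (1024 * d ^ 3) + W) * B <= n)%N.
Proof.
move=> d0 /andP[rn nr] r_big BE WE sE s0.
have r0 : (0 < r)%N by apply: leq_trans r_big; rewrite expn_gt0.
have r2 : (r.+1 <= 2 * r)%N by lia.
have hW : (2 * (W * B) <= n)%N.
  set m := trunc_log 2 r in WE.
  have m_big : (32 * d <= m)%N by apply: trunc_log_max.
  have m_sq : (m * m <= 2 ^ m)%N by apply: sqr_le_exp2; lia.
  have m_r : (2 ^ m <= r)%N by apply: trunc_logP.
  have W_r : (16 * d * W <= r)%N.
    by apply: leq_trans m_r; apply: leq_trans m_sq; rewrite WE; nia.
  rewrite BE; apply: leq_trans rn.
  apply: (leq_trans (n := (16 * d * W) * r)); last by rewrite leq_mul2r W_r orbT.
  have : (d * W * r.+1 <= d * W * (2 * r))%N by rewrite leq_mul2l r2 orbT.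
  by nia.
set c := (B * (4 * d))%N in sE.
have c0 : (0 < c)%N by rewrite /c BE !muln_gt0 d0.
set q := (_ %/ _ %/ _)%N.
(* Rounding [s] down costs at most a factor 2, because [s] is positive. *)
have hts : (t %/ s <= 2 * c)%N.
  have lt_t : (t < s.+1 * c)%N by rewrite sE -ltn_divLR.
  have le_t : (t <= 2 * c * s)%N by nia.
  by apply: leq_trans (leq_div2r s le_t) _; rewrite mulnK.
have hq : (q * (1024 * d ^ 3) <= 2 * c)%N by apply: leq_trans hts; apply: leq_divM.
have hqB : (2 * (q * B) <= n)%N.
  have h8 : (8 * (q * B) <= r.+1 * r.+1)%N.
    have d3 : (0 < 128 * d ^ 3)%N by rewrite muln_gt0 expn_gt0 d0.
    rewrite -(leq_pmul2l d3).
    have -> : (128 * d ^ 3 * (8 * (q * B)) = q * (1024 * d ^ 3) * B)%N by ring.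
    have -> : (128 * d ^ 3 * (r.+1 * r.+1) = 2 * c * B)%N by rewrite /c BE; ring.
    by rewrite leq_mul2r hq orbT.
  have : (r.+1 * r.+1 <= 2 * r * (2 * r))%N by apply: leq_mul.
  by nia.
by rewrite mulnDl; lia.
Qed.

(** Since [d >= 16] and [2 ^ W > r], the power [d ^ W] is at least [r ^ 4], while [n <= 4 * r ^ 2];
    a spare factor [r] absorbs [4 * M / eps]. *)
Lemma false_alarm_le {R : realType} (n r d W M : nat) (eps : R) :
  0 < eps -> (16 <= d)%N -> (0 < r)%N -> (n < r.+1 * r.+1)%N -> (r < 2 ^ W)%N ->
  4 * M%:R / eps <= r%:R ->
  (M * n)%:R * d%:R^-1 ^+ W <= eps.
Proof.
move=> eps0 d16 r0 nr rW r_big.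
have r0' : 1 <= r%:R :> R by rewrite ler1n.
have n4 : n%:R <= 4 * r%:R ^+ 2 :> R.
  by rewrite -natrX -natrM ler_nat; nia.
have pow : r%:R ^+ 4 <= d%:R ^+ W :> R.
  rewrite -!natrX ler_nat.
  have W0 : (0 < W)%N by case: W rW => //; rewrite ltnNge r0.
  apply: (leq_trans (n := 16 ^ W)); last by rewrite leq_exp2r.
  by rewrite -[16%N]/(2 ^ 4)%N -expnM mulnC expnM leq_exp2r // ltnW.
have M_r : 4 * M%:R <= eps * r%:R by move: r_big; rewrite ler_pdivrMr // [eps * _]mulrC.
have dW0 : 0 < d%:R ^+ W :> R by rewrite exprn_gt0 // ltr0n; lia.
rewrite exprVn ler_pdivrMr // natrM.
apply: le_trans (ler_wpM2l (ltW eps0) pow).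
apply: (le_trans (y := M%:R * (4 * r%:R ^+ 2))); first by rewrite ler_wpM2l ?ler0n.
apply: (le_trans (y := eps * r%:R * r%:R ^+ 2)).
  by rewrite mulrA ler_wpM2r ?exprn_ge0 ?ler0n // mulrC.
by rewrite -mulrA ler_wpM2l ?(ltW eps0) // -exprS ler_weXn2l.
Qed.

(** [W] is logarithmic in [n] and [l] in [W], so [10 * M * ln (ln n)] already bounds the left side.
    The lower bound on [n] makes the triple logarithm at least 1. *)
Lemma space_le {R : realType} (n r W l M : nat) :
  (0 < r)%N -> (r <= n)%N -> W = (trunc_log 2 r).+1 ->
  l = (trunc_log 2 W.+1).+1 -> expR (expR (expR 1)) <= n%:R :> R ->
  (2 * l * M)%:R <= (10 * M)%:R * ln (ln n%:R) * ln (ln (ln n%:R)) :> R.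
Proof.
move=> r0 rn WE lE n_big.
set u : R := ln n%:R; set v := ln u; set z := ln v.
have e1 : 2 <= expR 1 :> R by have := expR_ge1Dx (1 : R); lra.
have u_big : expR (expR 1) <= u by apply: le_ln_of_expR.
have v_big : expR 1 <= v by apply: le_ln_of_expR.
have z1 : 1 <= z by apply: le_ln_of_expR.
have u3 : 3 <= u.
  by apply: le_trans u_big; have := expR_ge1Dx (expR 1 : R); lra.
have W_u : W.+1%:R <= u ^+ 2.
  have : (trunc_log 2 r)%:R <= 2 * u.
    apply: le_2ln_of_exp2; rewrite -natrX ler_nat.
    by apply: leq_trans rn; apply: trunc_logP.
  by rewrite WE -!natr1 expr2; nra.
have l_v : l%:R <= 5 * v.
  have : (trunc_log 2 W.+1)%:R <= 2 * ln (u ^+ 2).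
    apply: le_2ln_of_exp2; apply: le_trans W_u.
    by rewrite -natrX ler_nat trunc_logP.
  rewrite lnXn; last by lra.
  by rewrite lE -natr1 -/v mulr2n; lra.
rewrite !natrM.
have M0 : 0 <= M%:R :> R by exact: ler0n.
have v0 : 0 <= v by lra.
apply: (le_trans (y := 10 * M%:R * v)); last by rewrite ler_peMr // !mulr_ge0.
rewrite [leRHS]mulrAC ler_wpM2r //.
by lra.
Qed.

Theorem theorem1p11 (R : realType) (c eps : R) (hc : 0 < c) (heps : 0 < eps) :
  exists (C : R) (N0 : nat),
  forall (n t : nat) (p : R),
    (N0 <= n)%N -> c * n%:R <= t%:R ->
    (Num.sqrt n%:R)^-1 <= p -> p <= 1 ->
    exists (Omega : finType) (mu : Omega -> R)
           (send : Omega -> nat -> seq bool -> 'I_t -> seq bool)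
           (decide : Omega -> seq bool -> 'I_t -> bool) (L : nat),
      (forall r, 0 <= mu r) /\ \sum_(r : Omega) mu r = 1 /\
      @space_bounded Omega n t L send /\
      L%:R <= C * ln (ln n%:R) * ln (ln (ln n%:R)) /\
      prob_out mu (@D0 R n t) send decide true <= eps /\
      prob_out mu (@D1 R n t p) send decide false <= eps.
Proof.
have [d0 d0_big] := nat_above (4 / eps).
pose d := (d0 + 16)%N; pose M := (1024 * d ^ 3)%N.
have d16 : (16 <= d)%N by rewrite leq_addl.
have d_gt0 : (0 < d)%N by apply: leq_trans d16.
have M_gt0 : (0 < M)%N by rewrite muln_gt0 expn_gt0 d_gt0.
have d_big : 4 / d%:R <= eps.
  rewrite ler_pdivrMr ?ltr0n // mulrC -ler_pdivrMr //.
  by apply: le_trans d0_big _; rewrite ler_nat leq_addr.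
have [R1 R1_big] := nat_above ((32 * d ^ 2)%:R / c).
have [R2 R2_big] := nat_above (4 * M%:R / eps).
have [N1 N1_big] := nat_above (expR (expR (expR 1)) : R).
(* The summands serve, in order, the fit of all trials into the stream, the positivity of the cell
   size [s], and the false alarm bound. *)
pose R0 := (2 ^ (32 * d) + R1 + R2)%N.
exists (10 * M)%:R, (R0 * R0 + N1)%N => n t p n_big tn hp p1.
have [r rn] := nat_sqrt n; have /andP[rn1 rn2] := rn.
have R0r : (R0 <= r)%N.
  have lt_sq : (R0 * R0 < r.+1 * r.+1)%N.
    by apply: leq_ltn_trans rn2; apply: leq_trans n_big; apply: leq_addr.
  by rewrite -ltnS ltnNge; apply/negP => h; move: lt_sq; rewrite ltnNge leq_mul.
have r_exp : (2 ^ (32 * d) <= r)%N.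
  by apply: leq_trans R0r; rewrite /R0 -addnA leq_addr.
have r_R1 : (R1 <= r)%N.
  by apply: leq_trans R0r; rewrite /R0 addnAC leq_addl.
have r_R2 : (R2 <= r)%N by apply: leq_trans R0r; apply: leq_addl.
have r_gt0 : (0 < r)%N by apply: leq_trans r_exp; rewrite expn_gt0.
have le_rn : (r <= n)%N by apply: leq_trans rn1; rewrite leq_pmulr.
have n_gt0 : (0 < n)%N by apply: leq_trans le_rn.
have n_exp : expR (expR (expR 1)) <= n%:R :> R.
  apply: le_trans N1_big _; rewrite ler_nat.
  by apply: leq_trans n_big; apply: leq_addl.
(* As [p >= 1 / sqrt n >= 1 / r.+1], a slot contains at least [4 * d] needle samples on average; [s]
   is the largest cell size with at most [1 / (4 * d)] noise hits per slot guaranteed. *)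
pose B := (4 * d * r.+1)%N; pose W := (trunc_log 2 r).+1.
pose s := (t %/ (B * (4 * d)))%N; pose l := (trunc_log 2 W.+1).+1.
have B_gt0 : (0 < B)%N by rewrite !muln_gt0 d_gt0.
have c_gt0 : (0 < B * (4 * d))%N by rewrite muln_gt0 B_gt0 muln_gt0 d_gt0.
have s_gt0 : (0 < s)%N.
  rewrite divn_gt0 // -(ler_nat R); apply: le_trans tn.
  apply: (le_trans (y := c * (r * r)%:R)); last by rewrite ler_pM2l // ler_nat.
  apply: (le_trans (y := ((32 * d ^ 2) * r)%:R)).
    rewrite ler_nat; have : (d * d * r.+1 <= d * d * (2 * r))%N.
      by rewrite leq_mul2l; apply/orP; right; lia.
    by rewrite /B; nia.
  rewrite [in leLHS]natrM [in leRHS]natrM mulrA ler_wpM2r ?ler0n //.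
  rewrite mulrC -ler_pdivrMr //; apply: le_trans R1_big _.
  by rewrite ler_nat.
have p0 : 0 <= p by apply: le_trans hp; rewrite invr_ge0 sqrtr_ge0.
have pB : (4 * d)%:R <= p * B%:R.
  have sq_gt0 : 0 < Num.sqrt n%:R :> R by rewrite sqrtr_gt0 ltr0n.
  have sq_le : Num.sqrt n%:R <= r.+1%:R :> R.
    rewrite -[leRHS]ger0_norm ?ler0n // -sqrtr_sqr ler_sqrt ?exprn_ge0 //.
    by rewrite -natrX ler_nat expnS expn1 ltnW.
  rewrite /B [(_ * r.+1)%:R]natrM mulrCA -[leLHS]mulr1 ler_wpM2l ?ler0n //.
  apply: (le_trans (y := (Num.sqrt n%:R)^-1 * r.+1%:R)).
    by rewrite mulrC ler_pdivlMr // mul1r.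
  by rewrite ler_wpM2r ?ler0n.
have L_gt0 : (0 < 2 * l * M)%N by rewrite [(0 < _ * M)%N]muln_gt0 M_gt0.
(* Each of the [M] tracks stores two numbers of [l] bits. *)
have states_le : ((W.+1 * W.+1) ^ M <= 2 ^ (2 * l * M))%N.
  have lt_W : (W.+1 < 2 ^ l)%N by apply: trunc_log_ltn.
  rewrite (expnM 2 (2 * l) M) leq_exp2r // mul2n -addnn expnD.
  by rewrite leq_mul // ltnW.
have fit := needle_fit n t d r s B W d_gt0 rn r_exp erefl erefl erefl s_gt0.
have [send [decide [spc err0 err1]]] :=
  needle_protocol n t d B W M s (2 * l * M) p (leq_trans (isT : 1 < 16)%N d16)
    B_gt0 isT M_gt0 s_gt0 n_gt0 L_gt0 states_le (leq_divM _ _) fit p0 p1 pB.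
exists unit, (fun=> 1), send, decide, (2 * l * M)%N.
split; first by move=> _; apply: ler01.
split; first by rewrite (big_pred1 tt) => [|[]].
split=> //; split; first exact: (space_le n r W l M).
split; last exact: le_trans err1 d_big.
apply: le_trans err0 _; apply: (false_alarm_le n r) => //.
- exact: trunc_log_ltn.
- by apply: le_trans R2_big _; rewrite ler_nat.
Qed.
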